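(* Let $V$ be a superspace and let $(a,b)$ be a local pair of $\mathrm{End}(V)$-valued fields. Then $$:ab:-p(a,b):ba:=\int_{-\partial}^0[a_\lambda b]\,d\lambda .$$
   Context: All vector spaces are over $\mathbb{C}$. $\mathrm{End}(V)$ is an associative superalgebra with superbracket $[x,y]=xy-p(x,y)yx$, $p(x,y)=(-1)^{p(x)p(y)}$. A formal distribution $a(z)=\sum_{n\in\mathbb{Z}}a_{(n)}z^{-n-1}$ has all modes of the same parity, which is its parity; it is an $\mathrm{End}(V)$-valued field if $a(z)v\in V[[z]][z^{-1}]$ for all $v\in V$. The pair $(a,b)$ is local if $(z-w)^N[a(z),b(w)]=0$ for some $N\ge0$. $\mathrm{Res}_z$ is the coefficient of $z^{-1}$; $\partial$ is derivation with respect to the formal variable. Put $a(z)_+=\sum_{n\le-1}a_{(n)}z^{-n-1}$ and $a(z)_-=\sum_{n\ge0}a_{(n)}z^{-n-1}$. The normal product is $:ab:=\,:a(w)b(w):=a(w)_+b(w)+p(a,b)b(w)a(w)_-$. For $j\ge0$, $a_{(j)}b=\mathrm{Res}_z(z-w)^j[a(z),b(w)]$ and $[a_\lambda b]=\sum_{j\ge0}\frac{\lambda^j}{j!}a_{(j)}b$ (a finite sum by locality). The formal integral is $\int_{-\partial}^0[a_\lambda b]\,d\lambda=\left.\sum_{n\ge0}\frac{\lambda^{n+1}}{(n+1)!}a_{(n)}b\right|_{\lambda=-\partial}^{\lambda=0}=-\sum_{n\ge0}\frac{(-\partial)^{n+1}}{(n+1)!}\left(a_{(n)}b\right)$. *)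

(* Defs.v *)
From HB Require Import structures.
From mathcomp Require Import all_boot all_order all_algebra finmap zify.
From mathcomp Require Import boolp classical_sets functions cardinality fsbigop.

Set Implicit Arguments.
Unset Strict Implicit.
Unset Printing Implicit Defensive.

Import Order.TTheory GRing.Theory Num.Theory.

Local Open Scope classical_set_scope.
Local Open Scope ring_scope.

(* [ss_part false] and [ss_part true] are the even and the odd subspace; V is
   their direct sum. Parities are elements of Z/2 = (bool, (+)). *)
Record superspace (K : fieldType) := Superspace {
  ss_space :> lmodType K;
  ss_part : bool -> set ss_space;
  ss_part0 : forall p, ss_part p 0;
  ss_part_linear : forall p k u v,
    ss_part p u -> ss_part p v -> ss_part p (k *: u + v);
  ss_part_direct : forall v : ss_space, exists! u : ss_space * ss_space,
    [/\ ss_part false u.1, ss_part true u.2 & v = u.1 + u.2]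
}.

Definition End (K : fieldType) (V : lmodType K) : Type := {linear V -> V}.

Definition End_fun (K : fieldType) (V : lmodType K) (f : End V) : V -> V :=
  GRing.Linear.sort f.
Coercion End_fun : End >-> Funclass.

Section EndAlgebra.
Variables (K : fieldType) (V : lmodType K).
Implicit Types f g h : End V.

Fact End_linear f : linear f.
Proof. exact: linearP. Qed.
HB.instance Definition _ f :=
  GRing.isLinear.Build K V V *:%R (End_fun f) (End_linear f).

Lemma End_eq f g : (forall v, f v = g v) -> f = g.
Proof.
case: f g => f [[f1] [f2]] [g [[g1] [g2]]] /= fg.
have e : f = g by apply/funext.
case: _ / e in g1 g2 fg *.
by rewrite (Prop_irrelevance f1 g1) (Prop_irrelevance f2 g2).
Qed.

Definition End0 : End V := [the {linear V -> V} of \0].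
Definition EndN f : End V := [the {linear V -> V} of \- f].
Definition EndD f g : End V := [the {linear V -> V} of f \+ g].
Definition EndZ (k : K) f : End V := [the {linear V -> V} of k \*: f].
Definition End1 : End V := [the {linear V -> V} of idfun].
Definition EndM f g : End V := [the {linear V -> V} of f \o g].

HB.instance Definition _ := gen_eqMixin (End V).
HB.instance Definition _ := gen_choiceMixin (End V).

Fact EndDA : associative EndD.
Proof. by move=> f g h; apply: End_eq => v; exact: addrA. Qed.
Fact EndDC : commutative EndD.
Proof. by move=> f g; apply: End_eq => v; exact: addrC. Qed.
Fact End0D : left_id End0 EndD.
Proof. by move=> f; apply: End_eq => v; exact: add0r. Qed.
Fact EndND : left_inverse End0 EndN EndD.
Proof. by move=> f; apply: End_eq => v; exact: addNr. Qed.
HB.instance Definition _ :=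
  GRing.isZmodule.Build (End V) EndDA EndDC End0D EndND.

Fact EndMA : associative EndM.
Proof. by move=> f g h; apply: End_eq. Qed.
Fact End1M : left_id End1 EndM.
Proof. by move=> f; apply: End_eq. Qed.
Fact EndM1 : right_id End1 EndM.
Proof. by move=> f; apply: End_eq. Qed.
Fact EndMDl : left_distributive EndM +%R.
Proof. by move=> f g h; apply: End_eq. Qed.
Fact EndMDr : right_distributive EndM +%R.
Proof. by move=> f g h; apply: End_eq => v; exact: raddfD. Qed.
HB.instance Definition _ :=
  GRing.Zmodule_isPzRing.Build (End V) EndMA End1M EndM1 EndMDl EndMDr.

Fact EndZA k l f : EndZ k (EndZ l f) = EndZ (k * l) f.
Proof. by apply: End_eq => v; exact: scalerA. Qed.
Fact End1Z : left_id 1 EndZ.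
Proof. by move=> f; apply: End_eq => v; exact: scale1r. Qed.
Fact EndZDr : right_distributive EndZ +%R.
Proof. by move=> k f g; apply: End_eq => v; exact: scalerDr. Qed.
Fact EndZDl f : {morph EndZ^~ f : k l / k + l}.
Proof. by move=> k l; apply: End_eq => v; exact: scalerDl. Qed.
HB.instance Definition _ :=
  GRing.Zmodule_isLmodule.Build K (End V) EndZA End1Z EndZDr EndZDl.

End EndAlgebra.

(* [a n] is the mode a_(n), that is the coefficient of z^(-n-1); sums and
   scalings are those of the function space. *)
Notation fdist V := (int -> End V).

(* [c m n] is the coefficient of z^(-m-1) w^(-n-1). *)
Notation fdist2 V := (int -> int -> End V).

Section FormalDistributions.
Variables (K : fieldType) (V : superspace K).

Definition has_parity (p : bool) (f : End V) : Prop :=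
  forall (q : bool) (v : V), ss_part q v -> ss_part (q (+) p) (f v).

Definition psign (p q : bool) : K := (-1) ^+ (p && q).

(* The superbracket of two endomorphisms of respective parities p and q. *)
Definition sbracket (p q : bool) (x y : End V) : End V :=
  x * y - psign p q *: (y * x).

(* The parity is part of the data since the zero distribution is both even
   and odd. The last condition is a(z)v \in V[[z]][z^-1]. *)
Record endfield := EndField {
  field_dist :> fdist V;
  parity : bool;
  field_parity : forall n, has_parity parity (field_dist n);
  field_laurent : forall v : V,
    exists N : int, forall n, N <= n -> field_dist n v = 0
}.

Definition fsign (a b : endfield) : K := psign (parity a) (parity b).

(* Multiplication by (z - w). *)
Definition mul_zw (c : fdist2 V) : fdist2 V :=
  fun m n => c (m + 1) n - c m (n + 1).

Definition Resz (c : fdist2 V) : fdist V := fun n => c 0 n.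

(* The derivative: d/dz z^(-n) = - n z^(-n-1). *)
Definition fd_der (a : fdist V) : fdist V := fun n => (- n)%:~R *: a (n - 1).

Definition commutator (a b : endfield) : fdist2 V :=
  fun m n => sbracket (parity a) (parity b) (a m) (b n).

Definition local (a b : endfield) : Prop :=
  exists N : nat, iter N mul_zw (commutator a b) = fun _ _ => 0.

Definition nproduct (j : nat) (a b : endfield) : fdist V :=
  Resz (iter j mul_zw (commutator a b)).

(* Polynomials in lambda with coefficients in [fdist V] are given by their
   sequence of coefficients, finitely supported for a local pair. *)
Definition lbracket (a b : endfield) : nat -> fdist V :=
  fun j => (j`!%:R)^-1 *: nproduct j a b.

Definition lprimitive (c : nat -> fdist V) : nat -> fdist V :=
  fun n => if n is m.+1 then (m.+1%:R)^-1 *: c m else 0.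

(* Substitution of an operator T for lambda, acting on the coefficients from
   the left; the sum is over the n with a nonzero term, and is 0 if there are
   infinitely many of them. *)
Definition eval_at (T : fdist V -> fdist V) (c : nat -> fdist V) : fdist V :=
  \sum_(n \in [set: nat]) iter n T (c n).

(* The integral over lambda from S to T. *)
Definition formal_integral (S T : fdist V -> fdist V) (c : nat -> fdist V) : fdist V :=
  eval_at T (lprimitive c) - eval_at S (lprimitive c).

Definition plus_part (a : fdist V) : fdist V := fun n => if n <= -1 then a n else 0.
Definition minus_part (a : fdist V) : fdist V := fun n => if 0 <= n then a n else 0.

(* The modes of the product a(w)b(w) are sums over all j of
   a_(j) b_(n-1-j); these must be finite on each vector. *)
Definition multipliable (a b : fdist V) : Prop :=
  forall (n : int) (v : V), finite_set [set j : int | a j (b (n - 1 - j) v) <> 0].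

Definition fd_mul_mode (a b : fdist V) (n : int) (v : V) : V :=
  \sum_(j \in [set: int]) a j (b (n - 1 - j) v).

Lemma fd_mul_mode_linear (a b : fdist V) (ab : multipliable a b) n :
  linear (fd_mul_mode a b n).
Proof.
move=> k u v; rewrite /fd_mul_mode.
pose A := fset_set [set j : int | a j (b (n - 1 - j) u) <> 0].
pose B := fset_set [set j : int | a j (b (n - 1 - j) v) <> 0].
have A0 j : j \notin (A `|` B)%fset -> a j (b (n - 1 - j) u) = 0.
  rewrite in_fsetU negb_or => /andP[+ _].
  by rewrite in_fset_set// notin_setE/= => /contrapT.
have B0 j : j \notin (A `|` B)%fset -> a j (b (n - 1 - j) v) = 0.
  rewrite in_fsetU negb_or => /andP[_].
  by rewrite in_fset_set// notin_setE/= => /contrapT.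
rewrite !(@fsbigTE _ _ _ _ (A `|` B)%fset)//=; last first.
  by move=> j jAB; rewrite !linearP/= A0// B0// scaler0 addr0.
rewrite scaler_sumr -big_split/=.
by apply: eq_bigr => j _; rewrite !linearP.
Qed.

Definition fd_mul (a b : fdist V) (ab : multipliable a b) : fdist V := fun n =>
  HB.pack_for {linear V -> V} (fd_mul_mode a b n)
    (GRing.isLinear.Build K V V *:%R (fd_mul_mode a b n)
      (fd_mul_mode_linear ab n)).

Fact finite_int_itv (x y : int) : finite_set [set j : int | x <= j < y].
Proof.
apply: (@sub_finite_set _ _ [set x + i%:Z | i in `I_(absz (y - x))]).
  by move=> j /= /andP[xj jy]; exists (absz (j - x)); lia.
exact/finite_image/finite_II.
Qed.

Lemma multipliable_plus (a b : endfield) : multipliable (plus_part a) b.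
Proof.
move=> n v; have [N bN] := field_laurent b v.
apply: sub_finite_set (finite_int_itv (n - N) 0) => j /= h.
apply/negP => jN; apply: h.
have [Nj|jN'] := lerP N (n - 1 - j); first by rewrite bN// linear0.
by rewrite /plus_part ifF//; lia.
Qed.

Lemma multipliable_minus (a b : endfield) : multipliable b (minus_part a).
Proof.
move=> n v; have [N aN] := field_laurent a v.
apply: sub_finite_set (finite_int_itv (n - N) n) => j /= h.
apply/negP => jN; apply: h; rewrite /minus_part.
case: ifPn => [j0|_]; last exact: linear0.
by rewrite aN ?linear0//; lia.
Qed.

Definition normal_product (a b : endfield) : fdist V :=
  fd_mul (multipliable_plus a b) + fsign a b *: fd_mul (multipliable_minus a b).

End FormalDistributions.

(* Main.v *)
Require Import Defs.
From mathcomp Require Import all_boot all_order all_algebra complex.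
From mathcomp Require Import finmap zify.
From mathcomp Require Import boolp classical_sets cardinality fsbigop.
From mathcomp Require Import functions reals.

(** Fix n and a vector v, put d = n - 1, and for an integer m let T(m) be the
    sum over all j of the products of the modes j of a and d - j of b, in the
    order a_(j) b_(d-j) when j < m and in the order p(a,b) b_(d-j) a_(j) when
    j >= m, applied to v. It is a finite sum since a and b are fields. Both
    normal products are such cut sums: mode n of :ab: is T(0)
    ([normal_productE]), and, after the substitution j -> n - 1 - j, mode n of
    p(a,b) :ba: is T(n) ([normal_product_swapE]). So the left-hand side is
    T(0) - T(n).

    Moving the cut from m to m + 1 reverses the order of one product only,
    whence T(m + 1) - T(m) = [a_(m), b_(d-m)] v ([cut_productS]). By locality
    and the commutator formula ([commutator_formula]) this bracket is the sum
    over k of binom(m, k) (a_(k) b)_(d-k). As a function of m, binom(m, k)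
    is the difference of binom(m, k + 1), which vanishes at m = 0; hence
    T(n) - T(0) is the sum over k of binom(n, k + 1) (a_(k) b)_(n-1-k) v
    ([cut_product_nproduct]).

    On the other side, mode n of the (k+1)-st power of minus the derivative of
    c is n (n - 1) ... (n - k) times mode n - k - 1 of c. With the factor
    1 / (k + 1)! this is again binom(n, k + 1), so that mode n of the formal
    integral is minus that sum ([formal_integral_lbracketE]). *)

Set Implicit Arguments.
Unset Strict Implicit.
Unset Printing Implicit Defensive.

Import Order.TTheory GRing.Theory Num.Theory.

Local Open Scope ring_scope.
Local Open Scope complex_scope.

(** * Difference equations on the integers *)

Section DiscreteCalculus.
Variable W : zmodType.

Lemma eq_int_seq (f g : int -> W) :
  f 0 = g 0 -> (forall m, f (m + 1) - f m = g (m + 1) - g m) -> f =1 g.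
Proof.
move=> fg0 fgS m; elim/int_rect: m => [//|n IH|n IH].
- have := fgS n; have -> : n%:Z + 1 = n.+1%:Z by lia.
  by rewrite IH => /addIr.
- have := fgS (- n.+1%:Z).
  have -> : - n.+1%:Z + 1 = - n%:Z by lia.
  by rewrite IH => /addrI /oppr_inj.
Qed.

End DiscreteCalculus.

(** * Binomial coefficients with an integral upper argument *)

Section GeneralizedBinomial.
Variable K : numFieldType.

Definition falling (x : int) (k : nat) : K := \prod_(i < k) (x - i%:Z)%:~R.

Definition binz (x : int) (k : nat) : K := (k`!%:R)^-1 * falling x k.

Lemma fallingSr x k : falling x k.+1 = falling x k * (x - k%:Z)%:~R.
Proof. exact: big_ord_recr. Qed.

Lemma fallingSl x k : falling x k.+1 = x%:~R * falling (x - 1) k.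
Proof.
rewrite /falling big_ord_recl subr0; congr (_ * _).
by apply: eq_bigr => i _; congr (_%:~R); rewrite lift0; lia.
Qed.

Lemma binz0 x : binz x 0 = 1.
Proof. by rewrite /binz /falling big_ord0 fact0 invr1 mulr1. Qed.

Lemma binz0S k : binz 0 k.+1 = 0.
Proof. by rewrite /binz fallingSl mul0r mulr0. Qed.

(** Pascal's rule in the form used for summation: the (k+1)-st binomial is a
    discrete antiderivative of the k-th, at negative arguments too. *)
Lemma binz_pascal x k : binz (x + 1) k.+1 - binz x k.+1 = binz x k.
Proof.
rewrite /binz -mulrBr fallingSl addrK fallingSr [falling x k * _]mulrC -mulrBl.
rewrite -rmorphB mulrA; congr (_ * _).
have -> : x + 1 - (x - k%:Z) = k.+1%:Z by lia.
by rewrite factS natrM invfM mulrAC mulVf ?mul1r// pnatr_eq0.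
Qed.

End GeneralizedBinomial.

(** * Finitely supported sums *)

Section FiniteSums.
Variables (K : fieldType) (W : lmodType K) (I : choiceType).

Lemma fsum_linear (k : K) (F G : I -> W) :
  finite_set [set i | F i <> 0]%classic ->
  finite_set [set i | G i <> 0]%classic ->
  \sum_(i \in [set: I]) (k *: F i + G i) =
  k *: \sum_(i \in [set: I]) F i + \sum_(i \in [set: I]) G i.
Proof.
move=> finF finG.
pose A := (fset_set [set i | F i <> 0]%classic
           `|` fset_set [set i | G i <> 0]%classic)%fset.
have AF i : i \notin A -> F i = 0.
  rewrite in_fsetU negb_or => /andP[+ _].
  by rewrite in_fset_set// notin_setE/= => /contrapT.
have AG i : i \notin A -> G i = 0.
  rewrite in_fsetU negb_or => /andP[_].
  by rewrite in_fset_set// notin_setE/= => /contrapT.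
rewrite !(@fsbigTE _ _ _ _ A)//=; last first.
  by move=> i iA; rewrite AF// AG// scaler0 addr0.
by rewrite scaler_sumr -big_split.
Qed.

Lemma fsum_scale (k : K) (F : I -> W) :
  finite_set [set i | F i <> 0]%classic ->
  \sum_(i \in [set: I]) (k *: F i) = k *: \sum_(i \in [set: I]) F i.
Proof.
move=> finF.
have fin0 : finite_set [set i : I | (0 : W) <> 0]%classic.
  by apply: sub_finite_set (finite_set0 _) => i /=.
have := fsum_linear k finF fin0; rewrite [X in _ + X]fsbig1// addr0 => <-.
by apply: eq_fsbigr => i _; rewrite addr0.
Qed.

End FiniteSums.

(** * The commutator formula *)

Section Fields.
Variables (K : numFieldType) (V : superspace K).
Implicit Types (a b : endfield V) (v : V) (d m n : int).

Lemma End_sumE (r : seq nat) (F : nat -> End V) v :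
  (\sum_(k <- r) F k) v = \sum_(k <- r) F k v.
Proof. by elim/big_rec2: _ => // k x y _ <-. Qed.

Lemma iter_mul_zw0 k : iter k (@mul_zw K V) (fun _ _ => 0) = fun _ _ => 0.
Proof.
elim: k => [//|k IH]; rewrite iterS IH.
by apply/funext => m; apply/funext => n; rewrite /mul_zw subr0.
Qed.

Lemma nproduct_ge (a b : endfield V) N k :
  iter N (@mul_zw K V) (commutator a b) = (fun _ _ => 0) -> (N <= k)%N ->
  nproduct k a b = 0.
Proof.
move=> cN0 Nk; rewrite /nproduct -(subnK Nk) iterD cN0 iter_mul_zw0.
exact/funext.
Qed.

(** On m |-> c m (d - m), multiplication by z - w is the difference operator in
    m, with d replaced by d - 1. A sequence with vanishing N-th difference is
    polynomial in m, and the formula is its Newton expansion at 0; the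
    induction integrates the expansion of (z - w) c. *)
Lemma commutator_formula (c : fdist2 V) N :
    iter N (@mul_zw K V) c = (fun _ _ => 0) ->
  forall d m, c m (d - m) =
    \sum_(0 <= k < N) binz K m k *: Resz (iter k (@mul_zw K V) c) (d - k%:Z).
Proof.
elim: N c => [|N IH] c cN0 d m; first by rewrite [c]cN0 big_geq.
rewrite iterSr in cN0.
pose S m := \sum_(0 <= k < N.+1)
  binz K m k *: Resz (iter k (@mul_zw K V) c) (d - k%:Z).
apply: (@eq_int_seq _ (fun m => c m (d - m)) S) => [|{}m].
  rewrite /S big_nat_recl// big1 => [|k _]; last by rewrite binz0S scale0r.
  by rewrite binz0 scale1r !addr0.
have -> : c (m + 1) (d - (m + 1)) - c m (d - m) = mul_zw c m (d - 1 - m).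
  by rewrite /mul_zw; congr (c _ _ - c _ _); lia.
rewrite (IH _ cN0) /S !big_nat_recl// !binz0 opprD addrACA subrr add0r.
rewrite -sumrB; apply: eq_bigr => k _.
rewrite -scalerBl binz_pascal -iterSr.
by congr (_ *: Resz _ _); lia.
Qed.

(** * Moving the cut in a normally ordered sum *)

(** The order on either side of the cut puts on the right the operator that
    eventually kills v: b_(d-j) for j very negative, a_(j) for j large. *)
Definition cut_term a b d v m : int -> V := fun j =>
  if j < m then a j (b (d - j) v) else fsign a b *: b (d - j) (a j v).

Definition cut_product a b d v m : V :=
  \sum_(j \in [set: int]) cut_term a b d v m j.

Lemma cut_term_finite a b d v m :
  finite_set [set j | cut_term a b d v m j <> 0]%classic.
Proof.
have [N aN] := field_laurent a v; have [M bM] := field_laurent b v.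
pose x := Order.min m (d - M); pose y := Order.max m N.
apply: sub_finite_set (finite_int_itv x y) => j /= h.
rewrite ge_min lt_max.
apply/negP => jN; apply: h; rewrite /cut_term.
have [jm|mj] := ltP j m; first by rewrite bM ?linear0//; lia.
by rewrite aN ?linear0 ?scaler0//; lia.
Qed.

(** Only the term of index m changes its order. *)
Lemma cut_productS a b d v m :
  cut_product a b d v (m + 1) - cut_product a b d v m =
  commutator a b m (d - m) v.
Proof.
rewrite addrC -scaleN1r.
rewrite -fsum_linear; [|exact: cut_term_finite|exact: cut_term_finite].
rewrite -(@fsbig_widen _ _ _ _ [set m]%classic)//; last first.
  move=> j /= [_ /eqP jm]; rewrite /cut_term.
  have -> : (j < m + 1) = (j < m) by lia.
  by rewrite scaleN1r addNr.
rewrite fsbig_set1 /cut_term ltxx ifT; last by lia.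
by rewrite scaleN1r addrC.
Qed.

Lemma cut_product_nproduct a b N d v m :
    iter N (@mul_zw K V) (commutator a b) = (fun _ _ => 0) ->
  cut_product a b d v m - cut_product a b d v 0 =
  (\sum_(0 <= k < N) binz K m k.+1 *: nproduct k a b (d - k%:Z)) v.
Proof.
move=> cN0; pose S m :=
  (\sum_(0 <= k < N) binz K m k.+1 *: nproduct k a b (d - k%:Z)) v.
apply: (@eq_int_seq _
  (fun m => cut_product a b d v m - cut_product a b d v 0) S) => [|{}m].
  by rewrite subrr /S big1// => k _; rewrite binz0S scale0r.
rewrite opprB addrA subrK cut_productS (commutator_formula cN0).
rewrite /S !End_sumE -sumrB; apply: eq_bigr => k _.
by rewrite -[RHS]scalerBl binz_pascal.
Qed.

Lemma fsum_reflect d (F : int -> V) :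
  \sum_(j \in [set: int]) F j = \sum_(j \in [set: int]) F (d - j).
Proof. by apply: reindex_fsbigT; exists (fun j => d - j) => j; lia. Qed.

Lemma finite_support_reflect d (F : int -> V) :
  finite_set [set j | F j <> 0]%classic ->
  finite_set [set j | F (d - j) <> 0]%classic.
Proof.
move=> finF.
apply: (@sub_finite_set _ _ ((fun j => d - j) @` [set j | F j <> 0]%classic)).
  by move=> j /= h; exists (d - j) => //; lia.
exact: finite_image.
Qed.

(** * The two sides of the identity *)

Lemma normal_productE a b n v :
  normal_product a b n v = cut_product a b (n - 1) v 0.
Proof.
rewrite [LHS]addrC /= {1}/fd_mul_mode (fsum_reflect (n - 1)).
rewrite -fsum_linear; last 2 first.
- apply: (@finite_support_reflect (n - 1)
    (fun j => b j (minus_part a (n - 1 - j) v))).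
  exact: multipliable_minus.
- exact: multipliable_plus.
apply: eq_fsbigr => j _; rewrite /cut_term /plus_part /minus_part.
have -> : n - 1 - (n - 1 - j) = j by lia.
have -> : (j <= -1) = (j < 0) by lia.
rewrite (leNgt 0 j); case: (j < 0) => /=; last by rewrite addr0.
by rewrite linear0 scaler0 add0r.
Qed.

Lemma fsign_sqr a b : fsign a b * fsign b a = 1.
Proof. by rewrite /fsign /psign andbC -expr2 sqrr_sign. Qed.

(** The index j of b in :ba: becomes the index n - 1 - j of a, so the cut moves
    from 0 to n and the orders on the two sides of it are exchanged; the sign
    moves from one order to the other since it squares to 1. *)
Lemma normal_product_swapE a b n v :
  fsign a b *: normal_product b a n v = cut_product a b (n - 1) v n.
Proof.
rewrite normal_productE /cut_product (fsum_reflect (n - 1)).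
rewrite -fsum_scale; last first.
  exact/finite_support_reflect/cut_term_finite.
apply: eq_fsbigr => j _.
rewrite /cut_term (_ : n - 1 - (n - 1 - j) = j); last by lia.
have [jn|nj] := ltP j n; last by rewrite ifT//; lia.
by rewrite ifF ?scalerA ?fsign_sqr ?scale1r//; lia.
Qed.

(** Mode n of - dc/dz is n times mode n - 1 of c, so the factors met along k
    steps are n, n - 1, ..., n - k + 1. *)
Lemma iter_NderE k (c : fdist V) n :
  iter k (fun c : fdist V => - fd_der c) c n = falling K n k *: c (n - k%:Z).
Proof.
elim: k n => [|k IH] n; first by rewrite /falling big_ord0 scale1r subr0.
rewrite iterS opprfctE /fd_der IH fallingSl scalerA -scaleNr -mulNr.
rewrite -rmorphN opprK.
by congr (_ *: c _); lia.
Qed.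

Lemma iter_Nder_lprimitive a b k n :
  iter k.+1 (fun c : fdist V => - fd_der c) (lprimitive (lbracket a b) k.+1) n =
  binz K n k.+1 *: nproduct k a b (n - 1 - k%:Z).
Proof.
rewrite iter_NderE /lprimitive /lbracket !scalrfctE !scalerA /binz factS natrM.
by rewrite invfM mulrC; congr (_ *: nproduct _ _ _ _); lia.
Qed.

Lemma formal_integral_lbracketE a b N n :
    iter N (@mul_zw K V) (commutator a b) = (fun _ _ => 0) ->
  formal_integral (fun c : fdist V => - fd_der c) (fun _ : fdist V => 0)
    (lbracket a b) n =
  - \sum_(0 <= k < N) binz K n k.+1 *: nproduct k a b (n - 1 - k%:Z).
Proof.
move=> cN0; rewrite /formal_integral /eval_at.
(* At 0 only the constant term would survive, and a primitive has none. *)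
rewrite fsbig1 ?sub0r => [|[|k]]//.
rewrite opprfctE; congr (- _).
have Nder0 k : iter k (fun c : fdist V => - fd_der c) 0 = 0.
  by apply/funext => i; rewrite iter_NderE scaler0.
rewrite -(@fsbig_widen _ _ _ _ `I_N.+1)//; last first.
  move=> k /= [_ /negP]; rewrite -leqNgt; case: k => // k Nk.
  by rewrite /lprimitive /lbracket (nproduct_ge cN0 Nk) !scaler0 Nder0.
rewrite -fsbig_ord -(big_mkord xpredT (fun k => iter k _ (lprimitive _ k))).
rewrite fct_sumE big_nat_recl// add0r; apply: eq_bigr => k _.
exact: iter_Nder_lprimitive.
Qed.

End Fields.

Theorem proposition3p3p4 (R : realType) (V : superspace R[i]) (a b : endfield V) :
  local a b ->
  normal_product a b - fsign a b *: normal_product b a =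
  formal_integral (fun c : fdist V => - fd_der c) (fun _ : fdist V => 0) (lbracket a b).
Proof.
move=> [N cN0]; apply/funext => n; rewrite (formal_integral_lbracketE n cN0).
apply: End_eq => v.
transitivity (normal_product a b n v - fsign a b *: normal_product b a n v) => //.
rewrite normal_productE normal_product_swapE -opprB.
by rewrite (cut_product_nproduct _ _ _ cN0).
Qed.
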